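(* Let $\alpha=(\alpha_n)_{n\in\mathbb{N}}$ be any sequence with $\alpha_n\uparrow\infty$. Then the Cesàro operator $\mathsf{C}$ acts continuously on $\Lambda_0(\alpha)$ (i.e. $\mathsf{C}$ maps $\Lambda_0(\alpha)$ into itself and $\mathsf{C}\colon\Lambda_0(\alpha)\to\Lambda_0(\alpha)$ is continuous) and, for each $k\in\mathbb{N}$, it satisfies $$p_k(\mathsf{C}x)\leq p_k(x),\qquad x\in\Lambda_0(\alpha).$$
   Context: Notation: $\mathbb{N}=\{1,2,3,\ldots\}$. The notation $\alpha_n\uparrow\infty$ means that $\alpha=(\alpha_n)_{n\in\mathbb{N}}\subseteq(1,\infty)$ satisfies $\alpha_n<\alpha_{n+1}$ for all $n\in\mathbb{N}$ and $\lim_{n\to\infty}\alpha_n=\infty$. For $k,n\in\mathbb{N}$ put $w_k(n):=e^{-\alpha_n/k}$. The power series space of finite type is $\Lambda_0(\alpha):=\{x\in\mathbb{C}^{\mathbb{N}}\colon \lim_{n\to\infty}w_k(n)|x_n|=0 \text{ for all } k\in\mathbb{N}\}$, a Fréchet space for the topology generated by the increasing sequence of norms $p_k(x):=\sup_{n\in\mathbb{N}}w_k(n)|x_n|$, $k\in\mathbb{N}$. The discrete Cesàro operator is the linear map $\mathsf{C}\colon\mathbb{C}^{\mathbb{N}}\to\mathbb{C}^{\mathbb{N}}$, $\mathsf{C}x:=\left(x_1,\frac{x_1+x_2}{2},\ldots,\frac{x_1+\cdots+x_n}{n},\ldots\right)$. *)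

(* Defs.v *)
From HB Require Import structures.
From mathcomp Require Import all_boot all_order all_algebra.
From mathcomp Require Import all_classical all_reals all_analysis.
From mathcomp Require Import complex.

Set Implicit Arguments.
Unset Strict Implicit.
Unset Printing Implicit Defensive.

Import Order.TTheory GRing.Theory Num.Theory.
Import numFieldNormedType.Exports.
Import Normc.

Local Open Scope classical_set_scope.
Local Open Scope ring_scope.

(* A sequence indexed by N = {1, 2, 3, ...} is a function on nat shifted by one:
   [x n] is the term written x_(n+1) on paper.  The index k of the weights and
   norms is not shifted; it ranges over the k : nat with 0 < k.
   Complex numbers are R[i]; [normc] is their modulus as an element of R. *)

Section PowerSeriesSpace.
Context {R : realType}.
Implicit Types (a : nat -> R) (k n : nat) (x y : nat -> R[i]).

Definition increases_to_infty a : Prop :=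
  [/\ forall n, 1 < a n, forall n, a n < a n.+1 & a n @[n --> \oo] --> +oo].

Definition weight a k n : R := expR (- (a n / k%:R)).

(* [sup] of an unbounded set is 0, but the set is bounded on [Lambda0 a]. *)
Definition pnorm a k x : R :=
  sup (range (fun n => weight a k n * normc (x n))).

Definition lambda0 a : {pred nat -> R[i]} := fun x =>
  `[< forall k, (0 < k)%N ->
        weight a k n * normc (x n) @[n --> \oo] --> (0 : R) >].

Definition discrete_cesaro x : nat -> R[i] :=
  fun n => (\sum_(i < n.+1) x i) / n.+1%:R.

Lemma lambda0_submod_closed a : submod_closed (lambda0 a).
Proof.
split.
  apply/asboolP => k _; rewrite [X in X @ _](_ : _ = fun=> 0); last first.
    by apply/funext => n; rewrite [X in normc X](_ : _ = 0) // normc0 mulr0.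
  exact: cvg_cst.
move=> c x y /asboolP xP /asboolP yP; apply/asboolP => k k0.
apply: (@squeeze_cvgr _ _ _ _ (fun=> 0)
  (fun n => normc c * (weight a k n * normc (x n)) +
            weight a k n * normc (y n))).
- near=> n.
  have w0 : 0 <= weight a k n by exact: expR_ge0.
  rewrite mulr_ge0 //=; last by case: (_ n) => u v; exact: sqrtr_ge0.
  rewrite mulrCA -mulrDr ler_wpM2l // -normcM.
  exact: le_normcD.
- exact: cvg_cst.
- have -> : (0 : R) = normc c * 0 + 0 by rewrite mulr0 addr0.
  by apply: cvgD; [apply: cvgMl_tmp; exact: xP | exact: yP].
Unshelve. all: end_near. Qed.

HB.instance Definition _ a :=
  GRing.isSubmodClosed.Build R[i] (nat -> R[i]) (lambda0 a)
    (lambda0_submod_closed a).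

Record Lambda0 a := MkLambda0 {
  seq_of_Lambda0 :> nat -> R[i];
  _ : seq_of_Lambda0 \in lambda0 a }.

HB.instance Definition _ a := [isSub for @seq_of_Lambda0 a].
HB.instance Definition _ a := [Choice of Lambda0 a by <:].
HB.instance Definition _ a := [SubChoice_isSubLmodule of Lambda0 a by <:].

HB.instance Definition _ a :=
  isPointed.Build (Lambda0 a) 0.

(* Topology generated by the norms [pnorm a k], 0 < k: the balls of all these
   norms, with arbitrary centre and radius r > 0, form a subbase. *)
HB.instance Definition _ a := @isSubBaseTopological.Build (Lambda0 a)
  (nat * Lambda0 a * R)%type
  [set i : nat * Lambda0 a * R | (0 < i.1.1)%N /\ 0 < i.2]
  (fun i => [set y : Lambda0 a | pnorm a i.1.1 (y - i.1.2) < i.2]).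

End PowerSeriesSpace.

(* Main.v *)
Require Import Defs.
From HB Require Import structures.
From mathcomp Require Import all_boot all_order all_algebra.
From mathcomp Require Import all_classical all_reals all_analysis.
From mathcomp Require Import complex.

Import Order.TTheory GRing.Theory Num.Theory.
Import numFieldNormedType.Exports.
Local Open Scope classical_set_scope.
Local Open Scope ring_scope.

(** Why the Cesaro operator contracts every norm.  Fix k.  Since the exponents
increase, the weight w at position n is at most the weight at every earlier
position i.  Moving w inside the average and the modulus therefore gives
[[
  w(n) |(x_0 + ... + x_n) / (n+1)|
     <= (w(0) |x_0| + ... + w(n) |x_n|) / (n+1),
]]
that is, the weighted moduli of the averaged sequence lie below the ordinary
Cesaro means of the weighted moduli of x ([le_cesaro_mean]).  Both claims about
the operator follow from this one bound.  Cesaro means of a null sequence form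
a null sequence, so the space is mapped into itself
([discrete_cesaro_lambda0]).  A mean of numbers that are at most p_k(x) is at
most p_k(x), so p_k does not grow ([pnorm_discrete_cesaro_le]).

Continuity is then a fact about the topology alone: an additive map that
increases none of the generating norms is continuous
([contractive_continuous]).  The triangle inequality used there, [pnormD],
rests on the suprema p_k(x) being finite on the space, as null sequences are
bounded ([le_pnorm]). *)

Section Modulus.
Context {R : rcfType}.
Implicit Type z : R[i].

Lemma normc_ge0 z : 0 <= Normc.normc z.
Proof. by case: z => u v; exact: sqrtr_ge0. Qed.

Lemma normc_natr n : Normc.normc (n%:R : R[i]) = n%:R.
Proof. by have := normcMn (1 : R[i]) n; rewrite Normc.normc1. Qed.

Lemma le_normc_sum (I : Type) (r : seq I) (F : I -> R[i]) :
  Normc.normc (\sum_(i <- r) F i) <= \sum_(i <- r) Normc.normc (F i).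
Proof.
elim/big_rec2: _ => [|i t z _ zt]; first by rewrite Normc.normc0.
by apply: le_trans (le_normcD _ _) _; rewrite lerD2l.
Qed.

End Modulus.

Section Seminorms.
Context {R : realType}.
Implicit Types (a : nat -> R) (k n : nat).

Lemma weighted_modulus_ge0 a k (x : nat -> R[i]) n :
  0 <= weight a k n * Normc.normc (x n).
Proof. by rewrite mulr_ge0 ?normc_ge0 // expR_ge0. Qed.

Lemma cvg_weighted_modulus a k (x : nat -> R[i]) : x \in lambda0 a -> (0 < k)%N ->
  weight a k n * Normc.normc (x n) @[n --> \oo] --> (0 : R).
Proof. by move/asboolP; apply. Qed.

(** A null sequence is bounded, so on [lambda0 a] the [sup] in [pnorm] is a
genuine supremum and not the value 0 given to unbounded sets. *)
Lemma le_pnorm a k (x : nat -> R[i]) n : x \in lambda0 a -> (0 < k)%N ->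
  weight a k n * Normc.normc (x n) <= pnorm a k x.
Proof.
move=> xa k0; apply: ub_le_sup; last by exists n.
apply/bounded_fun_has_ubound/cvg_seq_bounded/cvg_ex.
by exists 0; exact: cvg_weighted_modulus.
Qed.

Lemma pnorm_le a k (x : nat -> R[i]) (M : R) :
  (forall n, weight a k n * Normc.normc (x n) <= M) -> pnorm a k x <= M.
Proof.
move=> xM; apply: ge_sup; first by exists (weight a k 0 * Normc.normc (x 0)), 0%N.
by move=> _ [n _ <-].
Qed.

Lemma pnorm0 a k : (0 < k)%N -> pnorm a k 0 = 0.
Proof.
move=> k0; have z n : weight a k n * Normc.normc ((0 : nat -> R[i]) n) = 0.
  by rewrite [X in Normc.normc X](_ : _ = 0) // Normc.normc0 mulr0.
apply/eqP; rewrite eq_le; apply/andP; split.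
  by apply: pnorm_le => n; rewrite z.
by rewrite -[leLHS](z 0%N); apply: le_pnorm => //; exact: rpred0.
Qed.

Lemma pnormD a k (x y : Lambda0 a) : (0 < k)%N ->
  pnorm a k (x + y) <= pnorm a k x + pnorm a k y.
Proof.
move=> k0; apply: pnorm_le => n /=.
have le_xy := lerD (le_pnorm a k x n (valP x) k0) (le_pnorm a k y n (valP y) k0).
apply: le_trans le_xy.
by rewrite -mulrDr ler_wpM2l ?expR_ge0 // le_normcD.
Qed.

End Seminorms.

Section Topology.
Context {R : realType} (a : nat -> R).
Implicit Types (x y z : Lambda0 a) (k : nat).

Lemma nbhs_pnorm x k (r : R) : (0 < k)%N -> 0 < r ->
  nbhs x [set y : Lambda0 a | pnorm a k (y - x) < r].
Proof.
move=> k0 r0.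
pose b (i : nat * Lambda0 a * R) :=
  [set y : Lambda0 a | pnorm a i.1.1 (y - i.1.2) < i.2].
exists (b (k, x, r)); split => //=; last by rewrite /b /= subrr pnorm0.
exists [set b (k, x, r)]; last by rewrite bigcup_set1.
by move=> _ ->; apply: (@finI_from1 _ _ _ b (k, x, r)).
Qed.

(** A filter need only be tested on the subbase: it contains the finite
intersections of the sets that it contains, and every set above one of them. *)
Lemma cvg_subbase x (F : set_system (Lambda0 a)) : Filter F ->
  (forall k z r, (0 < k)%N -> pnorm a k (x - z) < r ->
     F [set y : Lambda0 a | pnorm a k (y - z) < r]) ->
  F --> x.
Proof.
move=> FF Fb A [_ [[D' D'D <-] [B D'B Bx] BA]].
(* [D'] is the family of basic sets whose union is the open set inside [A];
   it suffices to reach the member [B] of it that contains [x]. *)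
apply: filterS BA _; apply: (@filterS _ _ _ B).
  by move=> y By; exists B.
have [D DD EB] := D'D _ D'B.
rewrite -EB; apply: filter_bigI => -[[k z] r] iD.
move: (DD _ iD); rewrite inE /= => -[k0 r0].
by apply: Fb => //; move: Bx; rewrite -EB => /(_ _ iD).
Qed.

(** The neighbourhood to choose is forced by the triangle inequality in
[f y - z = f (y - x) + (f x - z)]: the ball of radius [r - pnorm a k (f x - z)]
around [x] is sent into the ball of radius [r] around [z]. *)
Lemma contractive_continuous (f : Lambda0 a -> Lambda0 a) :
  {morph f : x y / x - y} ->
  (forall k x, (0 < k)%N -> pnorm a k (f x) <= pnorm a k x) ->
  continuous f.
Proof.
move=> fB fle x; apply: (cvg_subbase (f x) (f @ x)).
  exact: (@fmap_filter _ _ f _ (@nbhs_filter (Lambda0 a) x)).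
move=> k z r k0 fxz.
have r0 : 0 < r - pnorm a k (f x - z) by rewrite subr_gt0.
apply: filterS (nbhs_pnorm x k _ k0 r0) => y yx.
suff: pnorm a k (f (y - x) + (f x - z)) < r by rewrite fB addrA subrK.
move: yx; rewrite /mkset ltrBrDr; apply: le_lt_trans.
by apply: le_trans (pnormD a k _ _ k0) _; rewrite lerD2r fle.
Qed.

End Topology.

Section Cesaro.
Context {R : realType}.
Implicit Types (a : nat -> R) (k n : nat).

Lemma weight_nonincreasing a k i n : nondecreasing_seq a -> (i <= n)%N ->
  weight a k n <= weight a k i.
Proof.
move=> ai le_in; rewrite ler_expR lerN2 ler_wpM2r ?invr_ge0 ?ler0n //.
exact: ai.
Qed.

(** Each term of the sum can trade the common factor [weight a k n] for its own
weight, which is at least as large. *)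
Lemma le_cesaro_mean a k (x : nat -> R[i]) n : nondecreasing_seq a ->
  weight a k n * Normc.normc (discrete_cesaro x n) <=
  arithmetic_mean (fun i => weight a k i * Normc.normc (x i)) n.
Proof.
move=> ha; rewrite /discrete_cesaro /arithmetic_mean /= seriesEord /=.
rewrite Normc.normcM Normc.normcV normc_natr.
rewrite mulrA mulrC ler_wpM2l ?invr_ge0 ?ler0n //.
apply: (@le_trans _ _ (weight a k n * \sum_(i < n.+1) Normc.normc (x i))).
  by rewrite ler_wpM2l ?expR_ge0 // le_normc_sum.
rewrite mulr_sumr; apply: ler_sum => i _.
by rewrite ler_wpM2r ?normc_ge0 // weight_nonincreasing // -ltnS.
Qed.

Lemma discrete_cesaro_lambda0 a (x : nat -> R[i]) : nondecreasing_seq a ->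
  x \in lambda0 a -> discrete_cesaro x \in lambda0 a.
Proof.
move=> ha xa; apply/asboolP => k k0.
apply: squeeze_cvgr (cvg_cst 0) (cesaro (cvg_weighted_modulus a k x xa k0)).
by near=> n; rewrite weighted_modulus_ge0 le_cesaro_mean.
Unshelve. all: end_near. Qed.

Lemma pnorm_discrete_cesaro_le a k (x : nat -> R[i]) : nondecreasing_seq a ->
  x \in lambda0 a -> (0 < k)%N ->
  pnorm a k (discrete_cesaro x) <= pnorm a k x.
Proof.
move=> ha xa k0; apply: pnorm_le => n.
apply: le_trans (le_cesaro_mean _ _ _ _ ha) _.
rewrite /arithmetic_mean /= seriesEord /= ler_pdivrMl ?ltr0n //.
rewrite mulr_natl -[X in _ *+ X]card_ord -sumr_const.
by apply: ler_sum => i _; exact: le_pnorm.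
Qed.

Lemma discrete_cesaroB (x y : nat -> R[i]) :
  discrete_cesaro (x - y) = discrete_cesaro x - discrete_cesaro y.
Proof.
apply/funext => n.
rewrite [RHS](_ : _ = discrete_cesaro x n - discrete_cesaro y n) //.
by rewrite /discrete_cesaro -mulrBl -sumrB.
Qed.

End Cesaro.

Theorem proposition2p4 (R : realType) (alpha : nat -> R)
    (halpha : increases_to_infty alpha) :
  (exists C : Lambda0 alpha -> Lambda0 alpha,
      (forall x : Lambda0 alpha, C x = discrete_cesaro x :> (nat -> R[i])) /\
      continuous C) /\
  (forall k : nat, (0 < k)%N -> forall x : Lambda0 alpha,
      pnorm alpha k (discrete_cesaro x) <= pnorm alpha k x).
Proof.
have ha : nondecreasing_seq alpha.
  by apply/nondecreasing_seqP => n; case: halpha => _ lt_alpha _; exact/ltW.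
have Cle k : (0 < k)%N -> forall x : Lambda0 alpha,
    pnorm alpha k (discrete_cesaro x) <= pnorm alpha k x.
  by move=> k0 x; apply: pnorm_discrete_cesaro_le => //; exact: valP.
split=> //.
exists (fun x => MkLambda0 (discrete_cesaro_lambda0 _ _ ha (valP x))).
split=> //; apply: contractive_continuous => [x y|k x k0]; last exact: Cle.
by apply: val_inj; rewrite /= discrete_cesaroB.
Qed.
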